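(* Let $\pi:\tilde\Gamma\to\Gamma$ be a free double cover of metric graphs. The volume of the tropical Prym variety $\mathrm{Prym}(\tilde\Gamma/\Gamma)$ is given by $$\mathrm{Vol}^2(\mathrm{Prym}(\tilde\Gamma/\Gamma))=\sum_{F\subset E(\Gamma)}4^{r(F)-1}w(F),$$ where the sum is taken over all odd genus one decompositions $F$ of $\Gamma$ (with respect to a choice of model), $r(F)$ is the rank of $F$, and $w(F)$ is the product of the lengths of the edges in $F$.
   Context: A metric graph $\Gamma$ is obtained from a finite graph $G$ (loops and multi-edges allowed) with positive edge lengths $\ell:E(G)\to\mathbb{R}_{>0}$; $(G,\ell)$ is a model of $\Gamma$. The genus is $g=|E(G)|-|V(G)|+1$. All graphs (in particular $\Gamma$ and $\tilde\Gamma$) are connected. A free double cover $\pi:\tilde\Gamma\to\Gamma$ is a length-preserving topological covering of degree two; it is given by a free double cover $p:\tilde G\to G$ of suitable models (2-to-1 on vertices and on edges, adjacency-preserving, and a local isomorphism at every vertex) with $\ell(p(\tilde e))=\ell(\tilde e)$. If $\Gamma$ has genus $g$ then $\tilde\Gamma$ has genus $2g-1$. Prym variety and its volume: divisors on a metric graph are finite integer combinations of points; principal divisors are the divisors of continuous piecewise-linear functions with integer slopes (coefficient at a point = sum of incoming slopes); $\mathrm{Pic}^0$ is degree-zero divisors modulo principal divisors, and is isomorphic to the Jacobian. $\mathrm{Prym}(\tilde\Gamma/\Gamma)$ is the connected component of the identity of the kernel of $\mathrm{Nm}:\mathrm{Pic}^0(\tilde\Gamma)\to\mathrm{Pic}^0(\Gamma)$,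 $\sum a_i\tilde p_i\mapsto\sum a_i\pi(\tilde p_i)$. It is a real torus of dimension $g-1$ with lattice $\mathrm{Ker}(\pi_*:H_1(\tilde\Gamma,\mathbb{Z})\to H_1(\Gamma,\mathbb{Z}))$, and it carries an intrinsic principal polarization which is half of the restriction of the polarization of $\mathrm{Jac}(\tilde\Gamma)$. The associated inner product on the lattice is $$(\gamma,\delta)_P=\frac12\sum_{\tilde e\in E(\tilde G)}\gamma_{\tilde e}\delta_{\tilde e}\ell(\tilde e),\quad \gamma=\sum\gamma_{\tilde e}\tilde e,\ \delta=\sum\delta_{\tilde e}\tilde e,$$ and the volume is computed with it: $\mathrm{Vol}^2(\mathrm{Prym}(\tilde\Gamma/\Gamma))=\det\big((\tilde\gamma_i,\tilde\gamma_j)_P\big)$ for any $\mathbb{Z}$-basis $\tilde\gamma_1,\dots,\tilde\gamma_{g-1}$ of $\mathrm{Ker}\,\pi_*$. An odd genus one decomposition $F$ of $\Gamma$ of rank $r(F)$, with respect to a model $G$, is a set $F\subset E(G)$ of (necessarily) $g-1$ edges such that $G\setminus F$ (vertices kept) consists of $r(F)$ connected components of genus one, each having connected preimage in $\tilde\Gamma$. The right-hand side of the formula does not depend on the choice of model. *)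

(* Defs.v *)
From mathcomp Require Import all_boot all_order all_algebra.
From mathcomp Require Import reals.

Set Implicit Arguments.
Unset Strict Implicit.
Unset Printing Implicit Defensive.

Import Order.TTheory GRing.Theory Num.Theory.

Local Open Scope ring_scope.

(* Finite graphs, loops and multiple edges allowed.  An edge e consists of the
   two half-edges (e, false) and (e, true), rooted at [endpt e false] and
   [endpt e true].  Thus e carries a reference orientation, from [endpt e false]
   to [endpt e true], which is only used to write down integral chains; graph
   maps are not required to respect it. *)
Record graph := Graph {
  vert : finType;
  edge : finType;
  endpt : edge -> bool -> vert }.

Definition dart (G : graph) : Type := (edge G * bool)%type.

Definition root_of (G : graph) (h : dart G) : vert G := endpt h.1 h.2.

Notation chain G := {ffun edge G -> int}.

Section Graphs.
Variable G : graph.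
Implicit Types (A C : {set vert G}) (S F : {set edge G}).

Definition adj S : rel (vert G) :=
  fun u v => [exists e in S, exists b : bool,
    (endpt e b == u) && (endpt e (~~ b) == v)].

(* A and S are meant to be the vertex and edge sets of a subgraph, so that
   the endpoints of the edges of S belong to A. *)
Definition connected_sub A S : bool :=
  (A != set0) && [forall u in A, forall v in A, connect (adj S) u v].

(* |S| - |A| + 1; the truncated subtraction is exact on connected subgraphs. *)
Definition genus_sub A S : nat := (#|S|.+1 - #|A|)%N.

Definition connected_graph : bool :=
  connected_sub [set: vert G] [set: edge G].

Definition genus : nat := genus_sub [set: vert G] [set: edge G].

(* The vertex sets of the connected components of G \ F (vertices kept). *)
Definition components F : {set {set vert G}} :=
  equivalence_partition (connect (adj (~: F))) [set: vert G].

Definition component_edges F C : {set edge G} :=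
  [set e | (e \notin F) && [forall b, endpt e b \in C]].

Definition boundary (c : chain G) (v : vert G) : int :=
  \sum_(e | endpt e true == v) c e - \sum_(e | endpt e false == v) c e.

(* H_1(G, Z), as the group of integral 1-cycles of the 1-dimensional complex G. *)
Definition is_cycle (c : chain G) : Prop := forall v, boundary c v = 0.

End Graphs.

(* A metric graph, presented by a model. *)
Record metric_graph (R : realType) := MetricGraph {
  model :> graph;
  len : edge model -> R;
  len_gt0 : forall e, 0 < len e }.

(* A free double cover X -> Y.  On half-edges it is
   (e, b) |-> (cov_edge e, b (+) cov_flip e): [cov_flip e] says whether the
   reference orientation of e is mapped to the opposite of that of its image.
   [cov_local] is the local isomorphism condition: the half-edges rooted at u
   are mapped bijectively to those rooted at the image of u. *)
Record free_double_cover (R : realType) (X Y : metric_graph R) :=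
FreeDoubleCover {
  cov_vert : vert X -> vert Y;
  cov_edge : edge X -> edge Y;
  cov_flip : edge X -> bool;
  cov_dart : dart X -> dart Y :=
    fun h => (cov_edge h.1, h.2 (+) cov_flip h.1);
  cov_root : forall h, root_of (cov_dart h) = cov_vert (root_of h);
  cov_vert2 : forall v, #|[set u | cov_vert u == v]| = 2%N;
  cov_edge2 : forall e, #|[set e' | cov_edge e' == e]| = 2%N;
  cov_local : forall u k, root_of k = cov_vert u ->
    exists! h, root_of h = u /\ cov_dart h = k;
  cov_len : forall e, len e = len (cov_edge e) }.

Section Lattices.
Variable R : realType.

(* A real torus (L (x) R) / L of dimension [tdim], given by its lattice L in an
   ambient abelian group together with a bilinear form on L, the inner product
   attached to a principal polarization. *)
Record polarized_torus := PolarizedTorus {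
  tambient : zmodType;
  tlattice : tambient -> Prop;
  tform : tambient -> tambient -> R;
  tdim : nat }.

Definition is_Zbasis (M : zmodType) (L : M -> Prop) (n : nat) (B : 'I_n -> M)
    : Prop :=
  (forall i, L (B i)) /\
  (forall x, L x -> exists! c : {ffun 'I_n -> int}, x = \sum_i B i *~ c i).

(* v is the square of the volume: the lattice has a basis of size [tdim], and
   the Gram determinant of every such basis is v. *)
Definition is_vol2 (T : polarized_torus) (v : R) : Prop :=
  (exists B : 'I_(tdim T) -> tambient T, is_Zbasis (@tlattice T) B) /\
  (forall B : 'I_(tdim T) -> tambient T, is_Zbasis (@tlattice T) B ->
     \det (\matrix_(i, j) tform (B i) (B j)) = v).

(* The edge length pairing, i.e. the polarization of Jac(X). *)
Definition jac_form (X : metric_graph R) (c d : chain X) : R :=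
  \sum_e (c e)%:~R * (d e)%:~R * len e.

End Lattices.

Section Prym.
Variables (R : realType) (X Y : metric_graph R) (p : free_double_cover X Y).

Definition pushforward (c : chain X) : chain Y :=
  [ffun e => \sum_(e' | cov_edge p e' == e) (-1) ^+ cov_flip p e' * c e'].

(* Ker (p_* : H_1(X, Z) -> H_1(Y, Z)) *)
Definition prym_lattice (c : chain X) : Prop :=
  is_cycle c /\ pushforward c = 0.

(* The principal polarization of the Prym variety is half of the restriction of
   the polarization of Jac(X). *)
Definition prym_form (c d : chain X) : R := 2^-1 * jac_form c d.

(* The identity component of the kernel of Nm : Pic^0(X) -> Pic^0(Y), as the
   real torus which it is under the identification of Pic^0 with the Jacobian. *)
Definition Prym : polarized_torus R :=
  @PolarizedTorus R (chain X) prym_lattice prym_form (genus Y).-1.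

Definition connected_preimage (F : {set edge Y}) (C : {set vert Y}) : bool :=
  connected_sub (cov_vert p @^-1: C) (cov_edge p @^-1: component_edges F C).

Definition odd_genus_one_decomposition (F : {set edge Y}) : bool :=
  (#|F| == (genus Y).-1) &&
  [forall C in components F,
    (genus_sub C (component_edges F C) == 1%N) && connected_preimage F C].

Definition decomposition_rank (F : {set edge Y}) : nat := #|components F|.

Definition weight (F : {set edge Y}) : R := \prod_(e in F) len e.

End Prym.

(* Main.v *)
Require Import Defs.
From mathcomp Require Import all_boot all_order all_algebra.
From mathcomp Require Import reals.
From HB Require Import structures.
From mathcomp Require Import fingroup perm ring.

Local Open Scope ring_scope.

Import Order.TTheory GRing.Theory Num.Theory.

Set Implicit Arguments.
Unset Strict Implicit.
Unset Printing Implicit Defensive.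

(** Number the two sheets of the cover over each vertex and each edge of Y.
    A chain of X killed by the pushforward is anti-invariant under the sheet
    exchange, so it is determined by its coefficients on one sheet, a vector a
    indexed by the edges of Y; it is a cycle iff a I = 0, where I is the signed
    incidence matrix of Y (rows indexed by edges, columns by vertices) whose
    signs record how the sheets are glued.  In these coordinates the form on
    the Prym lattice is the diagonal form of the edge lengths, because the two
    lifts of an edge contribute one half each.  If the rows of B form a basis
    of the lattice of all a with a I = 0, then Cauchy-Binet ([cauchy_binet])
    writes the Gram determinant as the sum, over the sets F of g - 1 edges, of
    w(F) times the square of the minor of B with columns in F.

    It remains to evaluate these minors ([prym_minor]).  Suppose that every
    component of Y minus F has connected preimage, and let r be the number of
    components.  A path of X over the remaining edges joining a point over the
    root of a component to a point over a vertex v shows that the rows of I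
    outside F generate all the vectors e_v + e_root; conversely these vectors
    generate every row, which is +-e_u +-e_v with u and v in one component.
    So the restriction of I to the complement of F is N H, where H is the
    square matrix with rows e_v + e_root, of determinant +-2^r, and N has a
    left inverse ([inc_factor]).

    For F empty, r = 1, I = N H and N is a split surjection with the same
    kernel as I.  Hence that kernel has a basis of the right size, and by
    complementary minors ([complementary_minors]) the F-minor of B is, up to
    sign, the minor of N on the complement of F, that is half of the minor of
    I.  For F with g - 1 elements, the same factorisation has N square, hence
    unimodular, so the minor of I is +-2^r and the square of the minor of B is
    4^(r-1).  If some component has disconnected preimage, the minor of I
    vanishes, because a sheet-alternating function on that component is killed
    by all the remaining edges ([det_inc0]).

    Finally the components automatically have genus one when their preimages
    are connected: a nonzero term in the expansion of the minor of I matches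
    vertices bijectively with incident remaining edges
    ([genus_one_components]). *)

(** * Determinants and integral matrices *)

Lemma det_sum_rows (R : comNzRingType) (E : finType) n
    (A : 'I_n -> E -> R) (B : E -> 'I_n -> R) :
  \det (\matrix_(i, j) \sum_e A i e * B e j) =
  \sum_(h : {ffun 'I_n -> E})
     (\prod_i A i (h i)) * \det (\matrix_(i, j) B (h i) j).
Proof.
pose AB s i e := A i e * B e ((s : 'S_n) i).
transitivity (\sum_(h : {ffun 'I_n -> E}) \sum_(s : 'S_n)
    (-1) ^+ s * \prod_i AB s i (h i)).
  rewrite exchange_big; apply: eq_bigr => /= s _; rewrite -big_distrr /=.
  congr (_ * _); rewrite -(bigA_distr_bigA (AB s)) /=.
  by apply: eq_bigr => i _; rewrite mxE.
apply: eq_bigr => h _; rewrite big_distrr /=; apply: eq_bigr => s _.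
rewrite mulrCA -big_split; congr (_ * _).
by apply: eq_bigr => i _; rewrite mxE.
Qed.

Lemma enumerate_inj (E : finType) n (h : 'I_n -> E) (F : {set E}) :
  [set h i | i in 'I_n] = F -> #|F| = n -> injective h.
Proof.
move=> imh cF; have /imset_injP injh : #|[set h i | i in 'I_n]| == #|'I_n|.
  by rewrite imh cF card_ord.
by move=> i j; apply: injh.
Qed.

(** Expand as in [det_sum_rows].  Only injective h contribute; those with image
    F are f F composed with the permutations s, and summing over s rebuilds the
    determinant of the F-columns of A. *)
Lemma cauchy_binet (R : comNzRingType) (E : finType) n
    (A : 'I_n -> E -> R) (B : E -> 'I_n -> R) (f : {set E} -> 'I_n -> E) :
    (forall F : {set E}, #|F| = n -> [set f F i | i in 'I_n] = F) ->
  \det (\matrix_(i, j) \sum_e A i e * B e j) =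
  \sum_(F : {set E} | #|F| == n)
     \det (\matrix_(i, j) A i (f F j)) * \det (\matrix_(i, j) B (f F i) j).
Proof.
move=> imf; rewrite det_sum_rows (bigID (fun h : {ffun 'I_n -> E} => injectiveb h)) /=.
rewrite addrC big1 ?add0r => [|h /injectivePn[i1 [i2 ne12 eqh]]]; last first.
  rewrite (determinant_alternate ne12) ?mulr0 // => j.
  by rewrite !mxE eqh.
rewrite (partition_big (fun h : {ffun 'I_n -> E} => [set h i | i in 'I_n])
  (fun F => #|F| == n)) /= => [|h /injectiveP injh]; last first.
  by rewrite card_imset // card_ord.
apply: eq_bigr => F /eqP cF; have imF := imf F cF.
have injf := enumerate_inj imF cF.
pose h_ (s : 'S_n) := [ffun i => f F (s i)].
have injh : injective h_.
  move=> s t /ffunP eqst; apply/permP => i; apply: injf.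
  by have := eqst i; rewrite !ffunE.
rewrite (eq_bigl (mem [set h_ s | s in 'S_n])) => [|h]; last first.
  apply/andP/imsetP => [[/injectiveP ih /eqP imh] | [s _ ->]]; last first.
    split; first by apply/injectiveP => i j; rewrite !ffunE => /injf /perm_inj.
    apply/eqP; rewrite -[RHS]imF; apply/setP => e; apply/imsetP/imsetP => -[i _ ->].
      by exists (s i); rewrite // ffunE.
    by exists (s^-1%g i); rewrite // ffunE permKV.
  have ex i : exists j, f F j == h i.
    have : h i \in F by rewrite -imh imset_f.
    by rewrite -{1}imF => /imsetP[j _ ->]; exists j.
  have injc : injective (fun i => xchoose (ex i)).
    move=> i j eqij; apply: ih.
    by rewrite -(eqP (xchooseP (ex i))) eqij (eqP (xchooseP (ex j))).
  exists (perm injc) => //; apply/ffunP => i.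
  by rewrite ffunE permE (eqP (xchooseP (ex i))).
rewrite big_imset => [|s t _ _ /injh //]; rewrite big_distrl /=.
apply: eq_bigr => s _.
have -> : \matrix_(i, j) B (h_ s i) j = row_perm s (\matrix_(i, j) B (f F i) j).
  by apply/matrixP => i j; rewrite !mxE ffunE.
rewrite row_permE det_mulmx det_perm mulrCA mulrA; congr (_ * _ * _).
by apply: eq_bigr => i _; rewrite !mxE ffunE.
Qed.

Lemma det_sq1 n (A B : 'M[int]_n) : A *m B = 1%:M -> \det A ^+ 2 = 1.
Proof.
case/mulmx1_unit; rewrite unitmxE => uA _; apply/eqP.
by rewrite sqrf_eq1.
Qed.

Lemma mulmx_det_eq0 (R : idomainType) r k (A : 'M[R]_(r, k)) (H : 'M[R]_k) :
  \det H != 0 -> A *m H = 0 -> A = 0.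
Proof.
move=> dH /(congr1 (mulmx^~ (\adj H))); rewrite mul0mx -mulmxA mul_mx_adj.
by rewrite mul_mx_scalar => /eqP; rewrite scalemx_eq0 (negPf dH) => /eqP.
Qed.

(** The bound on n makes the type of functions inhabited, hence allows a value
    for the sets of other cardinalities. *)
Lemma enumerate_sets (E : finType) n : (n <= #|E|)%N ->
  exists f : {set E} -> 'I_n -> E,
    forall F : {set E}, #|F| = n -> [set f F i | i in 'I_n] = F.
Proof.
move=> nE.
have ex (F : {set E}) : exists h : 'I_n -> E, #|F| = n -> [set h i | i in 'I_n] = F.
  have [cF|nF] := eqVneq #|F| n; last first.
    by exists (fun i => enum_val (widen_ord nE i)) => /eqP; rewrite (negPf nF).
  exists (fun i => enum_val (cast_ord (esym cF) i)) => _.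
  apply/setP => e; apply/imsetP/idP => [[i _ ->]|eF]; first exact: enum_valP.
  exists (cast_ord cF (enum_rank_in eF e)) => //.
  by rewrite cast_ordK enum_rankK_in.
by have [f fP] := fin_all_exists ex; exists f.
Qed.

(** Jacobi's theorem on complementary minors, up to sign, for a split surjection
    N and a basis B of its kernel:
    with P the unimodular matrix stacking a section S on top of B, and Q
    adjoining to N the coordinate vectors selected by f, the product P Q is
    block triangular with determinant the f-minor of B, while the determinant
    of Q is the g-minor of N. *)
Lemma complementary_minors k n m (em : (m = k + n)%N)
    (N : 'M[int]_(m, k)) (S : 'M[int]_(k, m)) (B : 'M[int]_(n, m))
    (f : 'I_n -> 'I_m) (g : 'I_k -> 'I_m) :
    S *m N = 1%:M -> B *m N = 0 ->
    (forall a : 'rV_m, a *m N = 0 -> exists c, a = c *m B) ->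
    injective f -> injective g -> (forall i j, f i != g j) ->
  \det (colsub f B) ^+ 2 = \det (rowsub g N) ^+ 2.
Proof.
move: N S B f g; subst m => N S B f g SN BN kerN injf injg fg.
pose P := col_mx S B.
(* Subtracting from a vector its section part leaves an element of the kernel. *)
have [P' P'P] : exists P', P' *m P = 1%:M.
  have ex (i : 'I_(k + n)) : exists x, x *m P = row i 1%:M.
    have [|c ec] := kerN (row i 1%:M - row i N *m S).
      by rewrite mulmxBl -mulmxA SN mulmx1 -row_mul mul1mx subrr.
    by exists (row_mx (row i N) c); rewrite mul_row_col -ec addrC subrK.
  have [x xP] := fin_all_exists ex; exists (\matrix_i x i).
  by apply/row_matrixP => i; rewrite row_mul rowK xP.
have dP := det_sq1 (mulmx1C P'P).
pose If : 'M[int]_(k + n, n) := \matrix_(i, j) (i == f j)%:R.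
pose Ig : 'M[int]_(k + n, k) := \matrix_(i, j) (i == g j)%:R.
have mulf r (A : 'M_(r, k + n)) : A *m If = colsub f A.
  apply/matrixP => i j; rewrite !mxE (bigD1 (f j)) //= mxE eqxx mulr1.
  by rewrite big1 ?addr0 // => l /negPf nl; rewrite mxE nl mulr0.
have mulg r (A : 'M_(r, k + n)) : A *m Ig = colsub g A.
  apply/matrixP => i j; rewrite !mxE (bigD1 (g j)) //= mxE eqxx mulr1.
  by rewrite big1 ?addr0 // => l /negPf nl; rewrite mxE nl mulr0.
have mulgT r (A : 'M_(k + n, r)) : Ig^T *m A = rowsub g A.
  by apply: trmx_inj; rewrite trmx_mul trmxK mulg; apply/matrixP => i j; rewrite !mxE.
have mulfT r (A : 'M_(k + n, r)) : If^T *m A = rowsub f A.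
  by apply: trmx_inj; rewrite trmx_mul trmxK mulf; apply/matrixP => i j; rewrite !mxE.
pose Q := row_mx N If.
have PQ : P *m Q = block_mx 1%:M (colsub f S) 0 (colsub f B).
  by rewrite mul_col_row SN BN !mulf.
pose G := col_mx Ig^T If^T.
have GQ : G *m Q = block_mx (rowsub g N) 0 (rowsub f N) 1%:M.
  rewrite mul_col_row !mulgT !mulfT; congr block_mx; apply/matrixP => i j.
    by rewrite !mxE eq_sym (negPf (fg _ _)).
  by rewrite !mxE (inj_eq injf).
have GG : G *m G^T = 1%:M.
  rewrite tr_col_mx !trmxK mul_col_row !mulgT !mulfT scalar_mx_block.
  congr block_mx; apply/matrixP => i j; rewrite !mxE.
  - by rewrite (inj_eq injg).
  - by rewrite eq_sym (negPf (fg _ _)).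
  - by rewrite (negPf (fg _ _)).
  by rewrite (inj_eq injf).
have := congr1 (fun A => \det A ^+ 2) PQ.
rewrite det_mulmx exprMn dP mul1r det_ublock det1 mul1r => <-.
have := congr1 (fun A => \det A ^+ 2) GQ.
by rewrite det_mulmx exprMn (det_sq1 GG) mul1r det_lblock det1 mulr1.
Qed.

(** Smith normal form L D U of N: a N = 0 iff the first k coordinates of
    a L vanish, so the last rows of the inverse of L form a basis. *)
Lemma kernel_basis k n m (em : (m = k + n)%N)
    (N : 'M[int]_(m, k)) (S : 'M[int]_(k, m)) :
    S *m N = 1%:M ->
  exists B : 'M[int]_(n, m), B *m N = 0 /\
    (forall a : 'rV_m, a *m N = 0 -> exists! c, a = c *m B).
Proof.
move: N S; subst m => N S SN.
have [L uL [U uU [d _ defN]]] := int_Smith_normal_form N.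
move: defN; set D := (X in L *m X) => defN.
(* A zero elementary divisor would contradict the surjectivity of N. *)
have nzd (i : 'I_k) : d`_i != 0.
  apply/eqP => d0.
  have : S *m L *m D *m U = 1%:M by rewrite -SN defN !mulmxA.
  move/mulmx1C; rewrite mulmxA => /matrixP /(_ i i).
  rewrite !mxE eqxx big1 => [|j _]; first by move/eqP; rewrite eq_sym oner_eq0.
  rewrite [D _ _]mxE; have [/= ->|_] := eqVneq (j : nat) i.
    by rewrite d0 mul0rn mulr0.
  by rewrite mulr0n mulr0.
have kerD (b : 'rV_(k + n)) : (b *m D == 0) = (lsubmx b == 0).
  apply/eqP/eqP => b0; apply/rowP => i; rewrite !mxE.
    have /rowP/(_ i) := b0; rewrite !mxE (bigD1 (lshift n i)) //= [D _ _]mxE eqxx.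
    rewrite big1 ?addr0 => [/eqP|j ji].
      by rewrite mulf_eq0 (negPf (nzd i)) orbF => /eqP.
    by rewrite mxE (negPf (ji : (j : nat) != i)) mulr0n mulr0.
  rewrite big1 // => j _; rewrite [D _ _]mxE.
  have [ji|_] := eqVneq (j : nat) i; last by rewrite mulr0n mulr0.
  have -> : j = lshift n i by apply: val_inj.
  by have /rowP/(_ i) := b0; rewrite !mxE => ->; rewrite mul0r.
have kerN (a : 'rV_(k + n)) : (a *m N == 0) = (lsubmx (a *m L) == 0).
  rewrite -kerD defN !mulmxA; apply/eqP/eqP => [aN|->]; last by rewrite mul0mx.
  by rewrite -[LHS](mulmxK uU) aN mul0mx.
exists (dsubmx (invmx L)); split.
  apply/row_matrixP => i; rewrite row_mul row0; apply/eqP; rewrite kerN.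
  rewrite -row_mul mul_dsub_mx mulVmx // scalar_mx_block block_mxEv col_mxKd.
  by rewrite row_row_mx row_mxKl row0.
move=> a /eqP; rewrite kerN => /eqP aL0.
have ea : a = rsubmx (a *m L) *m dsubmx (invmx L).
  rewrite -[LHS](mulmxK uL) -{1}[a *m L]hsubmxK -{1}[invmx L]vsubmxK aL0.
  by rewrite mul_row_col mul0mx add0r.
exists (rsubmx (a *m L)); split=> // c ec.
rewrite ec -mulmxA mul_dsub_mx mulVmx // scalar_mx_block block_mxEv col_mxKd.
by rewrite mul_mx_row mulmx0 mulmx1 row_mxKr.
Qed.

(** * Vectors with even coordinate sums *)

(** When r is idempotent this is the matrix of the basis e_i + r(e_i) of the
    sublattice of vectors whose coordinate sum over every fibre of r is even. *)
Definition even_mx k (r : 'I_k -> 'I_k) : 'M[int]_k :=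
  \matrix_(i, j) ((i == j)%:R + (r i == j)%:R).

(** Doubling the fixed rows of a unipotent matrix gives [even_mx r]. *)
Lemma det_even_mx k (r : 'I_k -> 'I_k) : (forall i, r (r i) = r i) ->
  \det (even_mx r) ^+ 2 = 4 ^+ #|[pred i | r i == i]|.
Proof.
move=> rr; pose d : 'rV[int]_k := \row_i (if r i == i then 2 else 1).
pose K : 'M[int]_k := \matrix_(i, j) ((r i != i) && (r i == j))%:R.
(* K only sends non-fixed points to fixed ones, so it squares to zero. *)
have KK : K *m K = 0.
  apply/matrixP => i j; rewrite !mxE big1 // => l _; rewrite !mxE.
  have [<-|] := eqVneq (r i) l; last by rewrite andbF mul0r.
  by rewrite rr eqxx mulr0.
have U1 : (1%:M + K) *m (1%:M - K) = 1%:M.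
  by rewrite mulmxBr mulmxDl !mulmx1 mulmxDl KK addr0 mul1mx addrK.
have -> : even_mx r = diag_mx d *m (1%:M + K).
  apply/matrixP => i j; rewrite mul_diag_mx !mxE.
  have [->|_] /= := eqVneq (r i) i; first by rewrite addr0 mulrDl mul1r.
  by rewrite mul1r.
rewrite det_mulmx exprMn (det_sq1 U1) mulr1 det_diag -prodrXl.
rewrite (bigID (fun i => r i == i)) /= [X in _ * X]big1 ?mulr1 => [|i ri]; last first.
  by rewrite mxE (negPf ri).
by rewrite -prodr_const; apply: eq_bigr => i ri; rewrite mxE ri.
Qed.

(** * Connectedness in graphs *)

Lemma adj_sym (G : graph) (S : {set edge G}) : symmetric (adj S).
Proof.
move=> u v; apply/exists_inP/exists_inP => -[e eS /existsP[b ab]];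
  by exists e => //; apply/existsP; exists (~~ b); rewrite negbK andbC.
Qed.

Lemma connect_adj_sym (G : graph) (S : {set edge G}) : connect_sym (adj S).
Proof. exact/sym_connect_sym/adj_sym. Qed.

Lemma sub_connect_adj (G : graph) (S T : {set edge G}) :
  S \subset T -> subrel (connect (adj S)) (connect (adj T)).
Proof.
move=> /subsetP sST; apply: connect_sub => u v /exists_inP[e eS ab].
by apply: connect1; apply/exists_inP; exists e => //; apply: sST.
Qed.

(** The components are the classes of the canonical representatives [root]. *)
Lemma card_components (G : graph) (F : {set edge G}) :
  #|components F| = #|[pred v | fingraph.root (adj (~: F)) v == v]|.
Proof.
pose cl x := [set y in [set: vert G] | connect (adj (~: F)) x y].
have inj : {in [pred v | fingraph.root (adj (~: F)) v == v] &, injective cl}.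
  move=> x y /eqP rx /eqP ry /setP/(_ y); rewrite !inE connect0 /=.
  by move/(fingraph.rootP (@connect_adj_sym _ _)); rewrite rx ry.
rewrite -(card_in_imset inj); apply: eq_card => C.
apply/imsetP/imsetP => [[x _ ->]|[x _ ->]]; last by exists x.
exists (fingraph.root (adj (~: F)) x); first by rewrite inE fingraph.root_root //; exact: connect_adj_sym.
apply/setP => y; rewrite !inE /=.
by rewrite -(same_connect (@connect_adj_sym _ _) (connect_root _ _)).
Qed.

(** * Signs describing a free double cover *)

Lemma two_to_one_sheets (A B : finType) (f : A -> B) :
    (forall b, #|[set a | f a == b]| = 2%N) ->
  exists (s : A -> bool) (g : B -> bool -> A),
    [/\ forall b c, f (g b c) = b, forall b c, s (g b c) = c
      & forall a, g (f a) (s a) = a].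
Proof.
move=> f2.
have ex b : exists q : A * A, q.1 != q.2 /\ [set a | f a == b] = [set q.1; q.2].
  have /cards2P[x [y [nxy e]]] : #|[set a | f a == b]| == 2%N by rewrite f2.
  by exists (x, y).
have {ex}[q qP] := fin_all_exists ex.
have fq a b : (f a == b) = (a == (q b).1) || (a == (q b).2).
  by have /setP/(_ a) := (qP b).2; rewrite !inE.
exists (fun a => a != (q (f a)).1), (fun b c => if c then (q b).2 else (q b).1).
have fg b c : f (if c then (q b).2 else (q b).1) = b.
  by apply/eqP; rewrite fq; case: c; rewrite eqxx ?orbT.
split=> // [b c|a].
  rewrite fg; case: c; rewrite ?eqxx // eq_sym; exact: (qP b).1.
have := fq a (f a); rewrite eqxx.
by case: eqP => [/esym //|_ /= /esym/eqP/esym].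
Qed.

(** The cover is trivialised over vertices and over edges separately: [sv] and
    [se] number the two sheets.  The cover is then recorded by the signs [eps]
    of half-edges, which tell whether the sheet number changes from the edge
    to its end. *)
Record sheets (R : realType) (X Y : metric_graph R) (p : free_double_cover X Y) :=
Sheets {
  sv : vert X -> bool;
  gv : vert Y -> bool -> vert X;
  se : edge X -> bool;
  ge : edge Y -> bool -> edge X;
  eps : edge Y -> bool -> bool;
  cov_gv : forall v c, cov_vert p (gv v c) = v;
  sv_gv : forall v c, sv (gv v c) = c;
  gv_sv : forall u, gv (cov_vert p u) (sv u) = u;
  cov_ge : forall e c, cov_edge p (ge e c) = e;
  se_ge : forall e c, se (ge e c) = c;
  ge_se : forall e, ge (cov_edge p e) (se e) = e;
  sv_endpt : forall e b,
    sv (endpt e b) = eps (cov_edge p e) (b (+) cov_flip p e) (+) se e }.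

Lemma cov_endpt (R : realType) (X Y : metric_graph R) (p : free_double_cover X Y)
    (e : edge X) b :
  cov_vert p (endpt e b) = endpt (cov_edge p e) (b (+) cov_flip p e).
Proof. by have := cov_root p (e, b). Qed.

(** The signs are well defined because the two lifts of a half-edge have
    different roots: this is injectivity of the cover near a vertex. *)
Lemma sheets_exist (R : realType) (X Y : metric_graph R)
  (p : free_double_cover X Y) : inhabited (sheets p).
Proof.
have [sv [gv [fgv sgv gsv]]] := two_to_one_sheets (cov_vert2 p).
have [se [ge [fge sge gse]]] := two_to_one_sheets (cov_edge2 p).
pose eps e b := sv (endpt (ge e false) (b (+) cov_flip p (ge e false))).
split; apply: (@Sheets _ _ _ p sv gv se ge eps) => // e' b.
rewrite /eps; set e0 := ge _ _;
have ce : cov_edge p e0 = cov_edge p e' by rewrite fge.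
have cv : cov_vert p (endpt e0 (b (+) cov_flip p e' (+) cov_flip p e0)) =
          cov_vert p (endpt e' b).
  by rewrite !cov_endpt ce addbK.
case se' : (se e'); last first.
  by rewrite addbF; have -> : e0 = e'; [rewrite -[RHS]gse se' | rewrite addbK].
rewrite addbT; apply/eqP/negPn/negP => nsv.
have eu : endpt e0 (b (+) cov_flip p e' (+) cov_flip p e0) = endpt e' b.
  rewrite -[RHS]gsv -cv -[LHS]gsv; congr gv; apply/eqP.
  by move: nsv; case: (sv _); case: (sv _).
have [h [_ uh]] := cov_local (u := endpt e' b) (cov_root p (e', b)).
have h1 := uh (e', b) (conj erefl erefl).
have h2 : h = (e0, b (+) cov_flip p e' (+) cov_flip p e0).
  by apply: uh; split; [exact: eu | rewrite /cov_dart /= ce addbK].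
by move: se'; have [-> _] : (e', b) = (e0, b (+) cov_flip p e' (+) cov_flip p e0);
  [rewrite -h1 h2 | rewrite sge].
Qed.

(** * The signed incidence matrix *)

Section Incidence.
Variables (R : realType) (X Y : metric_graph R) (p : free_double_cover X Y).
Variable s : sheets p.
Implicit Types (e : edge Y) (v : vert Y) (F T : {set edge Y}).

(** The boundary of the anti-invariant lift of e, read on the sheet 0. *)
Definition inc e v : int :=
  (-1) ^+ eps s e true * (endpt e true == v)%:R
  - (-1) ^+ eps s e false * (endpt e false == v)%:R.

(** The anti-invariant projection of the vertex u. *)
Definition point (u : vert X) v : int :=
  (-1) ^+ sv s u * (cov_vert p u == v)%:R.

Lemma point_endpt (e' : edge X) b v :
  point (endpt e' b) v =
  (-1) ^+ se s e' * ((-1) ^+ eps s (cov_edge p e') (b (+) cov_flip p e')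
    * (endpt (cov_edge p e') (b (+) cov_flip p e') == v)%:R).
Proof. by rewrite /point sv_endpt cov_endpt addbC signr_addb mulrA. Qed.

(** Each step of a path of X contributes +- the row of the edge below it: the
    anti-invariant projection commutes with boundaries. *)
Lemma inc_path T (u w : vert X) :
    connect (adj (cov_edge p @^-1: T)) u w ->
  exists a : edge Y -> int, (forall e, e \notin T -> a e = 0) /\
    forall v, \sum_e a e * inc e v = point w v - point u v.
Proof.
case/connectP => q + ->; elim: q u => [|x q IHq] u /=.
  by exists (fun=> 0); split=> // v; rewrite subrr big1 // => e _; rewrite mul0r.
case/andP => /exists_inP[e' e'T /existsP[b /andP[/eqP eu /eqP ex]]] /IHq[a [a0 asum]].
rewrite inE in e'T; set e := cov_edge p e' in e'T.
pose z : int := (-1) ^+ se s e' * (-1) ^+ (b (+) cov_flip p e').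
have zE v : z * inc e v = point x v - point u v.
  rewrite -eu -ex !point_endpt -mulrBr /z -mulrA addNb; congr (_ * _).
  by rewrite /inc -/e; case: (b (+) _) => /=; rewrite ?mulN1r ?opprB ?mul1r.
exists (fun e1 => a e1 + z * (e1 == e)%:R); split=> [e1 e1T|v].
  by rewrite a0 // add0r; case: eqP e1T => [->|]; rewrite ?e'T ?mulr0.
under eq_bigr do rewrite mulrDl; rewrite big_split /= asum (bigD1 e) //= eqxx.
rewrite mulr1 zE big1 ?addr0 => [|e1 /negPf ->]; last by rewrite mulr0 mul0r.
by rewrite addrA subrK.
Qed.

(** The connectedness condition of an odd decomposition, phrased on pairs of
    vertices so that it provides and denies paths without naming components;
    see [preimages_connectedE]. *)
Definition preimages_connected F : bool :=
  [forall u, forall w, connect (adj (~: F)) (cov_vert p u) (cov_vert p w) ==>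
    connect (adj (cov_edge p @^-1: (~: F))) u w].

(** A path avoiding the preimage of F stays over one component. *)
Lemma connect_lift F C (u w : vert X) :
    C \in components F -> cov_vert p u \in C ->
    connect (adj (cov_edge p @^-1: (~: F))) u w ->
  connect (adj (cov_edge p @^-1: component_edges F C)) u w.
Proof.
case/imsetP => x _ -> {C} + /connectP[q + ->].
elim: q u => [|y q IHq] u //= uC /andP[/exists_inP[e eF /existsP[b /andP[eu ey]]] yq].
rewrite !inE /= in eF uC.
have cxy : connect (adj (~: F)) x (cov_vert p y).
  apply: connect_trans uC (connect1 _); apply/exists_inP; exists (cov_edge p e).
    by rewrite inE.
  apply/existsP; exists (b (+) cov_flip p e).
  by rewrite -addNb -!cov_endpt (eqP eu) (eqP ey) !eqxx.
apply: connect_trans (IHq _ _ yq); last by rewrite !inE.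
apply: connect1; apply/exists_inP; exists e; last by apply/existsP; exists b; rewrite eu.
rewrite !inE eF /=; apply/forallP => c; rewrite !inE /=.
rewrite -[c](addbK (cov_flip p e)) -cov_endpt.
have : (c (+) cov_flip p e == b) || (c (+) cov_flip p e == ~~ b) by case: (c (+) _); case: (b).
by case/orP => /eqP ->; rewrite ?(eqP eu) ?(eqP ey).
Qed.

Lemma preimages_connectedE F :
  preimages_connected F = [forall C in components F, connected_preimage p F C].
Proof.
apply/forallP/forall_inP => [HF C CF|HF u].
  apply/andP; split.
    have /imsetP[x _ eC] := CF; apply/set0Pn; exists (gv s x false).
    by rewrite inE cov_gv eC !inE /=.
  apply/forall_inP => u uC; apply/forall_inP => w wC; rewrite !inE in uC wC.
  apply: connect_lift => //; move/forallP/(_ w)/implyP: (HF u); apply.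
  have /imsetP[x _ eC] := CF; move: uC wC; rewrite eC !inE /=.
  by rewrite (connect_adj_sym _ x); apply: connect_trans.
apply/forallP => w; apply/implyP => uw.
pose C := [set y in [set: vert Y] | connect (adj (~: F)) (cov_vert p u) y].
have /HF/andP[_ /forall_inP/(_ u)] : C \in components F by apply: imset_f.
rewrite !inE connect0 => /(_ isT)/forall_inP/(_ w); rewrite !inE uw => /(_ isT).
apply: sub_connect_adj; apply/subsetP => e; rewrite !inE.
by case/andP.
Qed.

Lemma connected_preimages0 : connected_graph X -> preimages_connected set0.
Proof.
case/andP => _ /forall_inP cX; apply/forallP => u; apply/forallP => w.
have /forall_inP/(_ w) := cX u (in_setT _); rewrite inE => /(_ isT) uw.
apply/implyP => _; apply: sub_connect_adj uw; apply/subsetP => e _.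
by rewrite !inE.
Qed.

Lemma card_components0 : connected_graph Y -> #|components (set0 : {set edge Y})| = 1%N.
Proof.
case/andP => /set0Pn[x _] /forall_inP cY.
have eC y : [set z in [set: vert Y] | connect (adj (~: set0)) y z] = setT.
  apply/setP => z; rewrite !inE /=.
  have /forall_inP/(_ z) := cY y (in_setT _); rewrite inE => /(_ isT).
  by rewrite setC0.
rewrite -(cards1 [set: vert Y]); apply: eq_card => C.
rewrite !inE; apply/imsetP/eqP => [[y _ ->]|->]; first exact: eC.
by exists x => //; rewrite eC.
Qed.

(** The chosen vertex of the component of Y minus F, at the level of matrix
    indices. *)
Definition root_ord F (i : 'I_#|vert Y|) : 'I_#|vert Y| :=
  enum_rank (fingraph.root (adj (~: F)) (enum_val i)).

Lemma det_root_mx F :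
  \det (even_mx (root_ord F)) ^+ 2 = 4 ^+ #|components F|.
Proof.
rewrite det_even_mx => [|i]; last first.
  by rewrite /root_ord enum_rankK fingraph.root_root //; exact: connect_adj_sym.
rewrite card_components; congr (_ ^+ _).
rewrite -[LHS]sum1_card -[RHS]sum1_card [RHS](reindex _ (onW_bij _ (@enum_val_bij (vert Y)))) /=.
apply: eq_bigl => i; rewrite !inE /root_ord.
by rewrite -(inj_eq (@enum_val_inj _ _)) enum_rankK.
Qed.

Lemma det_root_mx_neq0 F : \det (even_mx (root_ord F)) != 0.
Proof. by rewrite -sqrf_eq0 det_root_mx expf_eq0 andbF. Qed.

Definition inc_mx t (g : 'I_t -> edge Y) : 'M[int]_(t, #|vert Y|) :=
  \matrix_(i, j) inc (g i) (enum_val j).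

(** Both the edges outside F and the vectors e_v + e_root generate the lattice
    of vectors with even coordinate sum on every component. *)
Lemma inc_factor F t (g : 'I_t -> edge Y) :
    injective g -> [set g i | i in 'I_t] = ~: F -> preimages_connected F ->
  exists N S, inc_mx g = N *m even_mx (root_ord F) /\ S *m N = 1%:M.
Proof.
move=> injg img HF.
set H := even_mx _.
pose rt := fingraph.root (adj (~: F)).
pose delta (x : vert Y) : 'rV[int]_#|vert Y| := delta_mx 0 (enum_rank x).
have deltaE x j : delta x 0 j = (x == enum_val j)%:R.
  by rewrite mxE eqxx -[in RHS](enum_rankK x) (inj_eq enum_val_inj) eq_sym.
have deltaH x : delta x *m H = delta x + delta (rt x).
  rewrite -rowE; apply/rowP => j; rewrite [RHS]mxE !deltaE !mxE /root_ord enum_rankK.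
  congr (_%:R + _%:R).
    by rewrite -[in RHS](enum_rankK x) (inj_eq enum_val_inj).
  by rewrite -[in RHS](enum_rankK (rt x)) (inj_eq enum_val_inj).
have rtr x : rt (rt x) = rt x by apply: fingraph.root_root; exact: connect_adj_sym.
(* The row of an edge is +-e_u +-e_v, with u and v in the same component. *)
have exN i : exists x, row i (inc_mx g) = x *m H.
  have eF : g i \in ~: F by rewrite -img imset_f.
  set e := g i in eF *; set u := endpt e true; set v := endpt e false.
  have ruv : rt u = rt v.
    apply/(fingraph.rootP (@connect_adj_sym _ _))/connect1.
    by apply/exists_inP; exists e => //; apply/existsP; exists true; rewrite !eqxx.
  (* The last term is half of what the roots contribute: a sign (-1)^b is
     1 - 2b, and the row of H at a root is twice a basis vector. *)
  exists ((-1) ^+ eps s e true *: delta u - (-1) ^+ eps s e false *: delta v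
    + ((eps s e true)%:R - (eps s e false)%:R) *: delta (rt u)).
  rewrite mulmxDl mulmxBl -!scalemxAl !deltaH rtr -ruv.
  apply/rowP => j; rewrite !(deltaE, mxE) -/e /inc -/u -/v.
  by case: (eps s e true); case: (eps s e false); rewrite /= ?expr0 ?expr1; ring.
have [N1 N1P] := fin_all_exists exN.
have NH : inc_mx g = (\matrix_i N1 i) *m H.
  by apply/row_matrixP => i; rewrite row_mul rowK N1P.
(* A path joining the two sheets over v and over its root. *)
have exS (i : 'I_#|vert Y|) : exists y, y *m inc_mx g = row i H.
  set v := enum_val i.
  have : connect (adj (cov_edge p @^-1: (~: F))) (gv s (rt v) true) (gv s v false).
    have /forallP/(_ (gv s (rt v) true))/forallP/(_ (gv s v false))/implyP := HF; apply.
    by rewrite !cov_gv connect_adj_sym connect_root.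
  case/inc_path => a [a0 asum]; exists (\row_j a (g j)); apply/rowP => j.
  have := asum (enum_val j); rewrite /point !sv_gv !cov_gv expr0 expr1 mul1r mulN1r opprK => asumj.
  have -> : row i H = delta v *m H by rewrite -rowE enum_valK.
  rewrite deltaH [RHS]mxE !deltaE -asumj !mxE.
  rewrite (bigID [in ~: F]) /= [X in _ + X]big1 ?addr0 => [|e eF]; last first.
    by rewrite a0 ?mul0r.
  rewrite -img big_imset /= => [|k l _ _ /injg //].
  by apply: eq_bigr => k _; rewrite !mxE.
have [S1 S1P] := fin_all_exists exS.
exists (\matrix_i N1 i), (\matrix_i S1 i); split => //.
have SNH : (\matrix_i S1 i) *m (\matrix_i N1 i) *m H = H.
  by apply/row_matrixP => i; rewrite -mulmxA -NH row_mul rowK S1P.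
apply/eqP; rewrite -subr_eq0; apply/eqP; apply: (mulmx_det_eq0 (det_root_mx_neq0 F)).
by rewrite mulmxBl SNH mul1mx subrr.
Qed.

Lemma det_inc F (g : 'I_#|vert Y| -> edge Y) :
    injective g -> [set g i | i in 'I_#|vert Y|] = ~: F ->
  preimages_connected F -> \det (inc_mx g) ^+ 2 = 4 ^+ #|components F|.
Proof.
move=> injg img HF; have [N [S [-> SN]]] := inc_factor injg img HF.
by rewrite det_mulmx exprMn (det_sq1 (mulmx1C SN)) mul1r det_root_mx.
Qed.

(** If u and w over the same component are not connected over Y minus F, then
    the anti-invariant projection of the indicator function of the component
    of u is a nonzero vector killed by all remaining edges. *)
Lemma det_inc0 F (g : 'I_#|vert Y| -> edge Y) :
    [set g i | i in 'I_#|vert Y|] = ~: F -> ~~ preimages_connected F ->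
  \det (inc_mx g) = 0.
Proof.
move=> img; rewrite negb_forall => /existsP[u]; rewrite negb_forall => /existsP[w].
rewrite negb_imply => /andP[uw nuw]; set adjF := adj _ in nuw.
pose D x := connect adjF u x.
have symF : connect_sym adjF by exact: connect_adj_sym.
have De (e' : edge X) : cov_edge p e' \notin F -> D (endpt e' true) = D (endpt e' false).
  move=> eF; apply: (same_connect_r symF).
  apply: connect1; apply/exists_inP; exists e'; rewrite ?inE //.
  by apply/existsP; exists true; rewrite !eqxx.
pose y v : int := (D (gv s v false))%:R - (D (gv s v true))%:R.
have ysign v (c : bool) : (-1) ^+ c * y v = (D (gv s v c))%:R - (D (gv s v (~~ c)))%:R.
  by case: c; rewrite /y ?mul1r // mulN1r opprB.
(* The lift of e on sheet c ends on the sheet eps e b (+) c. *)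
have gve e b (c : bool) : gv s (endpt e b) (eps s e b (+) c) =
    endpt (ge s e c) (b (+) cov_flip p (ge s e c)).
  rewrite -[RHS](gv_sv s) cov_endpt sv_endpt cov_ge se_ge.
  by rewrite addbK.
have killed i : \sum_v inc (g i) v * y v = 0.
  have eF : g i \notin F by rewrite -in_setC -img imset_f.
  set e := g i in eF *.
  have incy b : \sum_v (-1) ^+ eps s e b * (endpt e b == v)%:R * y v =
      (-1) ^+ eps s e b * y (endpt e b).
    rewrite (bigD1 (endpt e b)) //= eqxx mulr1 big1 ?addr0 // => v.
    by rewrite eq_sym => /negPf ->; rewrite mulr0 mul0r.
  under eq_bigr do rewrite mulrBl; rewrite sumrB !incy !ysign.
  have Dc c : D (gv s (endpt e true) (eps s e true (+) c)) =
      D (gv s (endpt e false) (eps s e false (+) c)).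
    by rewrite !gve; case: (cov_flip _ _); rewrite /= De // cov_ge.
  have := Dc true; rewrite !addbT => ->; have := Dc false; rewrite !addbF => ->.
  by rewrite subrr.
(* If y = 0 then D is stable under the sheet exchange, so along a path of Y
   from the image of u to that of w it contains both points over each vertex,
   in particular w. *)
have [v yv] : exists v, y v != 0.
  apply/existsP; rewrite -[X in is_true X]negbK negb_exists; apply/negP => /forallP y0.
  have {y0}y0 v c : D (gv s v c) = D (gv s v (~~ c)).
    have := y0 v; rewrite negbK /y subr_eq0 => /eqP.
    by case: c; case: (D _); case: (D _).
  have step v v' : adj (~: F) v v' -> D (gv s v false) -> D (gv s v' false).
    case/exists_inP => e eF /existsP[b /andP[/eqP <- /eqP <-]].
    have := gve e b (eps s e b); rewrite addbb => ->.
    set e' := ge _ _ _; have := gve e (~~ b) (eps s e b); rewrite -/e' => E.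
    have eF' : cov_edge p e' \notin F by rewrite cov_ge -in_setC.
    have -> : D (gv s (endpt e (~~ b)) false) =
        D (gv s (endpt e (~~ b)) (eps s e (~~ b) (+) eps s e b)).
      by case: (_ (+) _) => //; rewrite y0.
    by rewrite E addNb; case: (_ (+) _) => /=; rewrite De.
  have Dall v c : D (gv s v false) -> D (gv s v c) by case: c => //; rewrite y0.
  suff : D (gv s (cov_vert p w) false).
    by move/(Dall _ (sv s w)); rewrite gv_sv; apply/negP.
  have : D (gv s (cov_vert p u) false).
    have := connect0 adjF u; rewrite -/(D u) -{1}(gv_sv s u).
    by case: (sv s u) => //; rewrite y0.
  case/connectP: uw => q + ->; elim: q (cov_vert p u) => //= v' q IHq v.
  by case/andP => /step vv' /IHq + /vv'; apply.
pose yc : 'cV[int]_#|vert Y| := \col_j y (enum_val j).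
have kc : inc_mx g *m yc = 0.
  apply/colP => i; rewrite !mxE -[RHS](killed i).
  rewrite [RHS](reindex _ (onW_bij _ (@enum_val_bij (vert Y)))) /=.
  by apply: eq_bigr => j _; rewrite !mxE.
have := congr1 (mulmx (\adj (inc_mx g))) kc.
rewrite mulmx0 mulmxA mul_adj_mx mul_scalar_mx => /colP/(_ (enum_rank v)).
rewrite !mxE enum_rankK => /eqP; rewrite mulf_eq0 (negPf yv) orbF.
by move/eqP.
Qed.

(** A nonzero term of the determinant matches every vertex with an incident
    edge outside F, bijectively; hence every component has as many edges as
    vertices. *)
Lemma genus_one_components F (g : 'I_#|vert Y| -> edge Y) C :
    injective g -> [set g i | i in 'I_#|vert Y|] = ~: F ->
    \det (inc_mx g) != 0 -> C \in components F ->
  genus_sub C (component_edges F C) = 1%N.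
Proof.
move=> injg img nzd CF.
have [sg nz] : exists sg : {perm 'I_#|vert Y|}, forall i, inc_mx g i (sg i) != 0.
  have [sg sgP|none] := pickP (fun sg : {perm 'I_#|vert Y|} => [forall i, inc_mx g i (sg i) != 0]).
    by exists sg; apply/forallP.
  case/eqP: nzd; apply: big1 => sg _; have /negbT := none sg.
  rewrite negb_forall => /existsP[i]; rewrite negbK => /eqP i0.
  by rewrite (bigD1 i) //= i0 mul0r mulr0.
pose phi v := g (sg^-1%g (enum_rank v)).
have injphi : injective phi by move=> v w /injg/perm_inj/enum_rank_inj.
have phi_inc v : exists b, endpt (phi v) b = v.
  have := nz (sg^-1%g (enum_rank v)); rewrite permKV mxE enum_rankK -/(phi v) /inc.
  case: (endpt (phi v) true =P v) => [|_]; first by exists true.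
  case: (endpt (phi v) false =P v) => [|_]; first by exists false.
  by rewrite !mulr0 subrr eqxx.
have sameC e b c : e \notin F -> (endpt e b \in C) = (endpt e c \in C).
  move=> eF; have /imsetP[x _ ->] := CF; rewrite !inE /=.
  apply: (same_connect_r (@connect_adj_sym _ _)).
  have [->|] := eqVneq b c; first exact: connect0.
  move=> bc; apply: connect1; apply/exists_inP; exists e; rewrite ?inE //.
  by apply/existsP; exists b; move: bc; case: b; case: c; rewrite //= !eqxx.
suff -> : component_edges F C = phi @: C by rewrite /genus_sub card_imset // subSnn.
apply/setP => e; rewrite inE; apply/andP/imsetP => [[eF /forallP eC]|[v vC ->]].
  have : e \in ~: F by rewrite inE.
  rewrite -img => /imsetP[i _ ei]; pose v := enum_val (sg i).
  have ev : e = phi v by rewrite /phi enum_valK permK.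
  exists v => //; have [b <-] := phi_inc v; rewrite -ev; exact: eC.
have eF : phi v \notin F by rewrite -in_setC -img /phi imset_f.
split=> //; apply/forallP => b; have [c ec] := phi_inc v.
by rewrite (sameC _ b c eF) ec.
Qed.

End Incidence.

(** * The Prym lattice as the kernel of the incidence matrix *)

Section PrymMatrix.
Variables (R : realType) (X Y : metric_graph R) (p : free_double_cover X Y).
Variable s : sheets p.
Implicit Types (e : edge Y) (v : vert Y) (F : {set edge Y}).

Local Notation m := #|edge Y|.

Lemma sum_edge_cover (M : nmodType) (G : edge X -> M) :
  \sum_e' G e' = \sum_(e : edge Y) (G (ge s e false) + G (ge s e true)).
Proof.
rewrite (partition_big (cov_edge p) xpredT) //=; apply: eq_bigr => e _.
have ne : ge s e true != ge s e false.
  by apply/eqP => /(congr1 (se s)); rewrite !se_ge.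
rewrite (bigD1 (ge s e false)) ?cov_ge //= (bigD1 (ge s e true)) ?cov_ge ?eqxx //=.
rewrite big1 ?addr0 // => e' /andP[/andP[/eqP <-]].
by move: (ge_se s e'); case: (se s e') => ->; rewrite eqxx.
Qed.

(** The coefficients of a chain of X along the sheet 0, in the orientation
    of Y. *)
Definition chain_row (c : chain X) : 'rV[int]_m :=
  \row_j ((-1) ^+ cov_flip p (ge s (enum_val j) false)
            * c (ge s (enum_val j) false)).

Definition row_chain (a : 'rV[int]_m) : chain X :=
  [ffun e' => (-1) ^+ cov_flip p e' * ((-1) ^+ se s e' * a 0 (enum_rank (cov_edge p e')))].

Lemma row_chainK : cancel row_chain chain_row.
Proof.
move=> a; apply/rowP => j; rewrite mxE ffunE se_ge cov_ge enum_valK.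
by rewrite mul1r signrMK.
Qed.

Lemma chain_row_is_zmod_morphism : zmod_morphism chain_row.
Proof. by move=> c d; apply/rowP => j; rewrite !mxE !ffunE mulrBr. Qed.

HB.instance Definition _ := GRing.isZmodMorphism.Build (chain X) 'rV[int]_m
  chain_row chain_row_is_zmod_morphism.

Lemma row_chain_is_zmod_morphism : zmod_morphism row_chain.
Proof. by move=> a b; apply/ffunP => e'; rewrite !ffunE !mxE !mulrBr. Qed.

HB.instance Definition _ := GRing.isZmodMorphism.Build 'rV[int]_m (chain X)
  row_chain row_chain_is_zmod_morphism.

Lemma mul_row_sum n (c : 'rV[int]_n) (B : 'M[int]_(n, m)) :
  c *m B = \sum_i row i B *~ c 0 i.
Proof.
by rewrite mulmx_sum_row; apply: eq_bigr => i _; rewrite -scaler_int intz.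
Qed.

(** The chains killed by the pushforward are the anti-invariant ones. *)
Lemma pushforward_eq0 (c : chain X) :
  pushforward p c = 0 <-> c = row_chain (chain_row c).
Proof.
have pE (d : chain X) e : pushforward p d e =
    (-1) ^+ cov_flip p (ge s e false) * d (ge s e false)
    + (-1) ^+ cov_flip p (ge s e true) * d (ge s e true).
  rewrite ffunE big_mkcond /= sum_edge_cover (bigD1 e) //= !cov_ge eqxx.
  rewrite big1 ?addr0 // => e1 /negPf ne.
  by rewrite !cov_ge ne addr0.
split=> [/ffunP c0|->]; last first.
  apply/ffunP => e; rewrite pE !ffunE !cov_ge !se_ge !signrMK.
  by rewrite mul1r mulN1r subrr.
apply/ffunP => e'; rewrite !ffunE !mxE enum_rankK.
have := c0 (cov_edge p e'); rewrite pE ffunE => /eqP; rewrite addr_eq0 => /eqP.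
case se' : (se s e') => H; last first.
  have -> : ge s (cov_edge p e') false = e' by rewrite -[RHS](ge_se s) se'.
  by rewrite mul1r signrMK.
rewrite H; have -> : ge s (cov_edge p e') true = e' by rewrite -[RHS](ge_se s) se'.
by rewrite mulN1r opprK signrMK.
Qed.

(** The two lifts of e contribute half each. *)
Lemma prym_form_row (a b : 'rV[int]_m) :
  prym_form (row_chain a) (row_chain b) =
  \sum_(e : edge Y) (a 0 (enum_rank e))%:~R * len e * (b 0 (enum_rank e))%:~R.
Proof.
rewrite /prym_form /jac_form sum_edge_cover mulr_sumr; apply: eq_bigr => e _.
have ce c : (row_chain a (ge s e c))%:~R * (row_chain b (ge s e c))%:~R * len (ge s e c)
    = (a 0 (enum_rank e))%:~R * len e * (b 0 (enum_rank e))%:~R :> R.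
  rewrite (cov_len p) cov_ge !ffunE !cov_ge -intrM mulrACA -expr2 sqrr_sign mul1r.
  by rewrite mulrACA -expr2 sqrr_sign mul1r intrM mulrAC.
by rewrite !ce; field.
Qed.

(** The boundary of an anti-invariant chain is anti-invariant, so its value at u
    is determined up to the sign of the sheet of u by the vertex below u. *)
Lemma boundary_row_chain (a : 'rV[int]_m) (u : vert X) :
  boundary (row_chain a) u =
  (-1) ^+ sv s u * \sum_e a 0 (enum_rank e) * inc s e (cov_vert p u).
Proof.
have endE (e' : edge X) b : (endpt e' b == u) =
    (endpt (cov_edge p e') (b (+) cov_flip p e') == cov_vert p u)
    && (eps s (cov_edge p e') (b (+) cov_flip p e') (+) se s e' == sv s u).
  rewrite -cov_endpt -sv_endpt.
  apply/eqP/andP => [<-|[/eqP ev /eqP es]]; first by rewrite !eqxx.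
  by rewrite -[LHS](gv_sv s) ev es gv_sv.
rewrite /boundary [X in X - _]big_mkcond [X in _ - X]big_mkcond -sumrB sum_edge_cover.
rewrite mulr_sumr; apply: eq_bigr => e _.
rewrite /inc !endE !ffunE !cov_ge !se_ge; set A := a 0 _.
case: (cov_flip p (ge s e false)); case: (cov_flip p (ge s e true)) => /=;
  case: (_ == cov_vert p u); case: (_ == cov_vert p u); rewrite /=;
  case: (eps s e true); case: (eps s e false); case: (sv s u);
  rewrite /= ?expr0 ?expr1; ring.
Qed.

Lemma prym_latticeE (c : chain X) :
  prym_lattice p c <->
  c = row_chain (chain_row c) /\ chain_row c *m inc_mx s enum_val = 0.
Proof.
rewrite /prym_lattice pushforward_eq0.
have bE (a : 'rV[int]_m) u : boundary (row_chain a) u =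
    (-1) ^+ sv s u * (a *m inc_mx s enum_val) 0 (enum_rank (cov_vert p u)).
  rewrite boundary_row_chain; congr (_ * _).
  rewrite (reindex _ (onW_bij _ (@enum_val_bij (edge Y)))) mxE /=.
  by apply: eq_bigr => j _; rewrite !mxE enum_rankK enum_valK.
split=> [[cyc e]|[e N0]]; split=> //.
  apply/rowP => j; have := cyc (gv s (enum_val j) false).
  by rewrite {1}e bE cov_gv enum_valK sv_gv mul1r => ->; rewrite mxE.
by move=> u; rewrite e bE N0 mxE mulr0.
Qed.

End PrymMatrix.

(** * The volume of the Prym variety *)

Section PrymVolume.
Variables (R : realType) (X Y : metric_graph R) (p : free_double_cover X Y).
Variable s : sheets p.
Hypotheses (connX : connected_graph X) (connY : connected_graph Y).
Implicit Types (e : edge Y) (v : vert Y) (F : {set edge Y}).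

Local Notation k := #|vert Y|.
Local Notation m := #|edge Y|.
Local Notation n := (genus Y).-1.

(** The case F empty of [inc_factor]: I is a split surjection followed by
    an injection H of index 2, so that both have the same kernel. *)
Lemma inc_split :
  exists (N : 'M[int]_(m, k)) (S : 'M[int]_(k, m)),
    inc_mx s enum_val = N *m even_mx (root_ord set0) /\ S *m N = 1%:M.
Proof.
apply: inc_factor; first exact: enum_val_inj; last exact: connected_preimages0.
apply/setP => e; rewrite !inE; apply/imsetP.
by exists (enum_rank e); rewrite ?enum_rankK.
Qed.

Lemma card_edgeE : m = (k + n)%N.
Proof.
have [N [S [_ /mulmx1_min km]]] := inc_split.
by rewrite /genus /genus_sub !cardsT subSn //= subnKC.
Qed.

Lemma kernel_inc (N : 'M[int]_(m, k)) r (A : 'M[int]_(r, m)) :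
  inc_mx s enum_val = N *m even_mx (root_ord set0) ->
  A *m inc_mx s enum_val = 0 <-> A *m N = 0.
Proof.
move=> ->; rewrite mulmxA; split=> [|->]; last by rewrite mul0mx.
exact: mulmx_det_eq0 (det_root_mx_neq0 _).
Qed.

Lemma prym_basis : exists B : 'I_n -> chain X, is_Zbasis (prym_lattice p) B.
Proof.
have [N [S [NE SN]]] := inc_split.
have [B [BN kerN]] := kernel_basis card_edgeE SN.
exists (fun i => row_chain s (row i B)); split=> [i|x /(prym_latticeE s)[ex xN]].
  apply/(prym_latticeE s); rewrite row_chainK; split=> //.
  by apply/(kernel_inc _ NE); rewrite -row_mul BN row0.
have [c [ec uc]] := kerN _ ((kernel_inc _ NE).1 xN).
exists [ffun i => c 0 i]; split=> [|d ed].
  rewrite ex ec mul_row_sum raddf_sum; apply: eq_bigr => i _.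
  by rewrite raddfMz ffunE.
apply/ffunP => i; rewrite ffunE (uc (\row_j d j)) ?mxE //.
rewrite ed raddf_sum mul_row_sum; apply: eq_bigr => j _.
by rewrite raddfMz /= row_chainK mxE.
Qed.

(** When the preimages are connected, the minor of I on the complement of F is
    nonzero, and this forces genus one. *)
Lemma connected_odd F :
  odd_genus_one_decomposition p F = (#|F| == n) && preimages_connected p F.
Proof.
rewrite /odd_genus_one_decomposition (preimages_connectedE s).
have [cF|//] := eqVneq #|F| n; rewrite /=.
apply/forall_inP/forall_inP => HF C CF; first by case/andP: (HF C CF).
rewrite HF // andbT.
have cC : #|~: F| = k.
  by have := cardsC F; rewrite cF [in RHS]card_edgeE addnC => /addIn.
have kE : (k <= m)%N by rewrite [m]card_edgeE leq_addr.
have [g /(_ _ cC) img] := enumerate_sets kE.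
have injg := enumerate_inj img cC.
apply/eqP/(genus_one_components (s := s) injg img) => //.
rewrite -sqrf_eq0 (det_inc s injg img) ?expf_eq0 ?andbF //.
by rewrite (preimages_connectedE s); apply/forall_inP.
Qed.

(** Passing from N to I = N H multiplies complementary minors by +-2, so four
    times the squared minor of B is the squared complementary minor of I. *)
Lemma prym_minor (B : 'M[int]_(n, m)) F (f : 'I_n -> edge Y) :
    B *m inc_mx s enum_val = 0 ->
    (forall a : 'rV_m, a *m inc_mx s enum_val = 0 -> exists c, a = c *m B) ->
    #|F| = n -> [set f i | i in 'I_n] = F ->
  \det (\matrix_(i, j) B i (enum_rank (f j))) ^+ 2 =
    if preimages_connected p F then 4 ^+ (#|components F|).-1 else 0.
Proof.
move=> BI kerI cF imf; have injf := enumerate_inj imf cF.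
have [N [S [NE SN]]] := inc_split.
have cC : #|~: F| = k.
  by have := cardsC F; rewrite cF [in RHS]card_edgeE addnC => /addIn.
have kE : (k <= m)%N by rewrite [m]card_edgeE leq_addr.
have [g_ /(_ _ cC) img] := enumerate_sets kE.
move: (g_ _) img => g img; have injg := enumerate_inj img cC.
have BN : B *m N = 0 by apply/(kernel_inc _ NE).
have kerN (a : 'rV_m) : a *m N = 0 -> exists c, a = c *m B.
  by move/(kernel_inc _ NE); exact: kerI.
pose fo i := enum_rank (f i); pose go i := enum_rank (g i).
have ifo : injective fo by move=> i j /enum_rank_inj/injf.
have igo : injective go by move=> i j /enum_rank_inj/injg.
have fgo i j : fo i != go j.
  apply/eqP => /enum_rank_inj fg.
  have : g j \in ~: F by rewrite -img imset_f.
  by rewrite inE -fg -imf imset_f.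
have -> : \matrix_(i, j) B i (enum_rank (f j)) = colsub fo B.
  by apply/matrixP => i j; rewrite !mxE.
rewrite (complementary_minors card_edgeE SN BN kerN ifo igo fgo).
have det4 : \det (inc_mx s g) ^+ 2 = \det (rowsub go N) ^+ 2 * 4.
  have -> : inc_mx s g = rowsub go N *m even_mx (root_ord set0).
    rewrite mul_rowsub_mx -NE; apply/matrixP => i j.
    by rewrite !mxE enum_rankK.
  by rewrite det_mulmx exprMn det_root_mx card_components0.
have nz4 : (4 : int) != 0 by [].
apply: (mulIf nz4); rewrite -det4; case: ifP => [HF|/negbT HF].
  rewrite (det_inc s injg img HF) -exprSr prednK //.
  have /set0Pn[v _] : [set: vert Y] != set0 by case/andP: connY.
  by apply/card_gt0P; eexists; apply: (imset_f _ (in_setT v)).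
by rewrite (det_inc0 s img HF) expr0n mul0r.
Qed.

(** Cauchy-Binet for B L B^T, with L the diagonal matrix of edge lengths. *)
Lemma prym_gram (B : 'I_n -> chain X) : is_Zbasis (prym_lattice p) B ->
  \det (\matrix_(i, j) prym_form (B i) (B j)) =
  \sum_(F | odd_genus_one_decomposition p F)
    4 ^+ (decomposition_rank F).-1 * weight F.
Proof.
case=> LB genB; pose M : 'M[int]_(n, m) := \matrix_i chain_row s (B i).
have BE i : B i = row_chain s (row i M).
  by rewrite rowK; have /(prym_latticeE s)[] := LB i.
have MI : M *m inc_mx s enum_val = 0.
  apply/row_matrixP => i; rewrite row_mul rowK row0.
  by have /(prym_latticeE s)[] := LB i.
have kerM (a : 'rV_m) : a *m inc_mx s enum_val = 0 -> exists c, a = c *m M.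
  move=> aI; have [|c [ec _]] := genB (row_chain s a).
    by apply/(prym_latticeE s); rewrite row_chainK; split.
  exists (\row_i c i); rewrite -[LHS](row_chainK s) ec raddf_sum mul_row_sum.
  by apply: eq_bigr => i _; rewrite raddfMz rowK mxE.
have nE : (n <= m)%N by rewrite [m]card_edgeE leq_addl.
have [f imf] := enumerate_sets nE.
clearbody M.
pose A i e : R := (M i (enum_rank e))%:~R * len e.
pose A' e j : R := (M j (enum_rank e))%:~R.
have -> : \matrix_(i, j) prym_form (B i) (B j) = \matrix_(i, j) \sum_e A i e * A' e j.
  apply/matrixP => i j; rewrite !mxE !BE prym_form_row.
  by apply: eq_bigr => e _; rewrite !mxE.
rewrite (cauchy_binet A A' imf) (eq_bigl _ _ connected_odd) big_mkcondr /=.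
apply: eq_bigr => F /eqP cF.
pose MF := \matrix_(i, j) M i (enum_rank (f F j)).
have injf := enumerate_inj (imf F cF) cF.
have -> : \matrix_(i, j) A i (f F j) =
    map_mx intr MF *m diag_mx (\row_j (len (f F j) : R)).
  by apply/matrixP => i j; rewrite mul_mx_diag !mxE.
have -> : \matrix_(i, j) A' (f F i) j = (map_mx intr MF)^T.
  by apply/matrixP => i j; rewrite !mxE.
rewrite det_mulmx det_tr det_diag det_map_mx mulrAC -expr2 -rmorphXn /=.
rewrite (prym_minor MI kerM cF (imf F cF)) /decomposition_rank.
have -> : \prod_i (\row_j (len (f F j) : R)) 0 i = weight F.
  rewrite /weight -[in RHS](imf F cF) big_imset /= => [|i j _ _ /injf //].
  by apply: eq_bigr => i _; rewrite mxE.
by case: ifP => _; rewrite ?mul0r // rmorphXn /=.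
Qed.

End PrymVolume.

Theorem theorem1 (R : realType) (X Y : metric_graph R)
    (p : free_double_cover X Y)
    (connX : connected_graph X) (connY : connected_graph Y) :
  is_vol2 (Prym p)
    (\sum_(F : {set edge Y} | odd_genus_one_decomposition p F)
       4 ^+ (decomposition_rank F).-1 * weight F).
Proof.
have [s] := sheets_exist p; split; first exact: (prym_basis s connX).
by move=> B; apply: (prym_gram s connX connY).
Qed.
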